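(* Let $(B,g_B)$ and $(F,g_F)$ be singular semi-Riemannian manifolds, let $f\in C^\infty(B)$ (with zeros and negative values allowed), and let $B\times_f F$ be their degenerate warped product, with metric $\langle\cdot,\cdot\rangle$. Let $X,Y,Z$ be vector fields on $B\times F$ that are lifts of vector fields on $B$, and let $U,V,W$ be vector fields on $B\times F$ that are lifts of vector fields on $F$. Let $\mathcal K$ be the Koszul form of $B\times_f F$, and let $\mathcal K_B,\mathcal K_F$ be the lifts to $B\times F$ of the Koszul forms of $(B,g_B)$ and $(F,g_F)$ respectively. Then: \begin{enumerate} \item $\mathcal K(X,Y,Z)=\mathcal K_B(X,Y,Z)$. \item $\mathcal K(X,Y,W)=\mathcal K(X,W,Y)=\mathcal K(W,X,Y)=0$. \item $\mathcal K(X,V,W)=\mathcal K(V,X,W)=-\mathcal K(V,W,X)=f\,\langle V,W\rangle_F\,X(f)$. \item $\mathcal K(U,V,W)=f^2\,\mathcal K_F(U,V,W)$. \end{enumerate}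
   Context: A singular semi-Riemannian manifold $(M,g)$ is a smooth manifold $M$ with a smooth symmetric bilinear form $g=\langle\cdot,\cdot\rangle$ on $TM$ (called the metric), which may be degenerate and may have variable signature. $\mathfrak X(M)$ denotes the smooth vector fields on $M$. The Koszul form of $(M,g)$ is, for $X,Y,Z\in\mathfrak X(M)$, the smooth function $$\mathcal K(X,Y,Z):=\tfrac12\{X\langle Y,Z\rangle+Y\langle Z,X\rangle-Z\langle X,Y\rangle-\langle X,[Y,Z]\rangle+\langle Y,[Z,X]\rangle+\langle Z,[X,Y]\rangle\}.$$ Degenerate warped product: given singular semi-Riemannian manifolds $(B,g_B)$, $(F,g_F)$ and $f\in C^\infty(B)$, $B\times_f F$ is the manifold $B\times F$ with metric $\pi_B^*g_B+(f\circ\pi_B)^2\,\pi_F^*g_F$, where $\pi_B,\pi_F$ are the canonical projections; that is, $\langle x,y\rangle=\langle d\pi_B(x),d\pi_B(y)\rangle_B+f^2\langle d\pi_F(x),d\pi_F(y)\rangle_F$, with $\langle\cdot,\cdot\rangle_B=g_B$ and $\langle\cdot,\cdot\rangle_F=g_F$. Lifts: the lift of a vector field $X_B$ on $B$ is the unique vector field on $B\times F$ that is $\pi_B$-related to $X_B$ and tangent to the submanifolds $B\times\{q\}$; similarly for lifts from $F$. A function on $B$ or $F$ is identified with its pullback to $B\times F$. For lifts $X,Y,Z$ of $X_B,Y_B,Z_B\in\mathfrak X(B)$, $\mathcal K_B(X,Y,Z)$ denotes the pullback by $\pi_B$ of the function $\mathcal K_B(X_B,Y_B,Z_B)$ on $B$;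 similarly for $\mathcal K_F$. For lifts $V,W$ of $V_F,W_F\in\mathfrak X(F)$, $\langle V,W\rangle_F$ denotes the pullback of $g_F(V_F,W_F)$. *)

(* Defs.v *)
From HB Require Import structures.
From mathcomp Require Import all_boot all_order all_algebra.
From mathcomp Require Import all_classical reals topology normedtype derive.
From mathcomp Require Import ring.

Set Implicit Arguments.
Unset Strict Implicit.
Unset Printing Implicit Defensive.

Import Order.TTheory GRing.Theory Num.Theory.
Import numFieldNormedType.Exports.

Local Open Scope classical_set_scope.
Local Open Scope ring_scope.

Section SmoothOn.
Context {R : realType}.
Implicit Types V W : normedModType R.

(* All iterated directional derivatives of f up to order k exist and are
   continuous on U; this is meant for open U. *)
Fixpoint Ck_on {V W} (k : nat) (U : set V) (f : V -> W) : Prop :=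
  (forall x, U x -> {for x, continuous f}) /\
  if k is k'.+1 then
    (forall v x, U x -> derivable f x v) /\ (forall v, Ck_on k' U ('D_v f))
  else True.

Definition smooth_on {V W} (U : set V) (f : V -> W) : Prop :=
  forall k, Ck_on k U f.

Lemma Ck_on_cont {V W} k (U : set V) (f : V -> W) x :
  Ck_on k U f -> U x -> {for x, continuous f}.
Proof. by case: k => [|k] [+ _]; exact. Qed.

Lemma Ck_onW {V W} k (U : set V) (f : V -> W) : Ck_on k.+1 U f -> Ck_on k U f.
Proof.
elim: k f => [|k IH] f [fc [fd fk]]; first by split.
by split => //; split => // v; exact/IH/fk.
Qed.

Lemma Ck_on_sub {V W} k (U U' : set V) (f : V -> W) :
  U' `<=` U -> Ck_on k U f -> Ck_on k U' f.
Proof.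
move=> sU; elim: k f => [|k IH] f [fc fk]; split; do ?by move=> x /sU/fc.
  by [].
by split=> [v x /sU|v]; [exact: fk.1|exact/IH/fk.2].
Qed.

Lemma Ck_on_ext {V W} k (U : set V) (f g : V -> W) : open U ->
  (forall x, U x -> f x = g x) -> Ck_on k U f -> Ck_on k U g.
Proof.
move=> oU; elim: k f g => [|k IH] f g fg [fc fk].
all: have E x : U x -> \forall y \near x, f y = g y by
  move=> Ux; apply: filterS (open_nbhs_nbhs (conj oU Ux)) => y; exact: fg.
all: have gc x : U x -> {for x, continuous g} by
  move=> Ux; rewrite /prop_for /continuous_at -(fg _ Ux);
  exact: cvg_trans (near_eq_cvg (E _ Ux)) (fc _ Ux).
  by split.
split=> //; split=> [v x Ux|v].
  by apply: near_eq_derivable (fk.1 v _ Ux); exact: E.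
by apply: IH (fk.2 v) => x Ux; apply: near_eq_derive; exact: E.
Qed.

Lemma Ck_on_cst {V W} k (U : set V) (c : W) : Ck_on k U (cst c : V -> W).
Proof.
elim: k c => [|k IH] c; split; do ?by move=> x _; exact: cvg_cst.
  by [].
split=> [v x _|v]; first exact: derivable_cst.
have -> : 'D_v (cst c : V -> W) = cst 0 by apply/funext => x; rewrite derive_cst.
exact: IH.
Qed.

Lemma Ck_onD {V W} k (U : set V) (f g : V -> W) : open U ->
  Ck_on k U f -> Ck_on k U g -> Ck_on k U (f + g).
Proof.
move=> oU; elim: k f g => [|k IH] f g [fc fk] [gc gk].
all: have fgc x : U x -> {for x, continuous (f + g)} by
  move=> Ux; apply: cvgD; [exact: fc|exact: gc].
  by split.
split=> //; split=> [v x Ux|v].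
  by apply: derivableD; [exact: fk.1|exact: gk.1].
apply: Ck_on_ext (IH _ _ (fk.2 v) (gk.2 v)) => // x Ux.
by rewrite deriveD //; [exact: fk.1|exact: gk.1].
Qed.

Lemma Ck_onM {V} k (U : set V) (f g : V -> R) : open U ->
  Ck_on k U f -> Ck_on k U g -> Ck_on k U (f * g).
Proof.
move=> oU; elim: k f g => [|k IH] f g Hf Hg.
all: have fgc x : U x -> {for x, continuous (f * g)} by
  move=> Ux; apply: cvgM; [exact: Ck_on_cont Hf Ux|exact: Ck_on_cont Hg Ux].
  by split.
have [[_ [fd fk]] [_ [gd gk]]] := (Hf, Hg).
split=> //; split=> [v x Ux|v].
  by apply: derivableM; [exact: fd|exact: gd].
apply: Ck_on_ext (Ck_onD oU (IH _ _ (Ck_onW Hf) (gk v))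
                            (IH _ _ (Ck_onW Hg) (fk v))) => // x Ux.
by rewrite deriveM //; [exact: fd|exact: gd].
Qed.

Lemma Ck_on_lin {V W W' : normedModType R} k (U : set V) (f : V -> W)
    (L : {linear W -> W'}) : open U -> continuous L ->
  Ck_on k U f -> Ck_on k U (L \o f).
Proof.
move=> oU Lc; elim: k f => [|k IH] f [fc fk].
all: have Lfc x : U x -> {for x, continuous (L \o f)} by
  move=> Ux; exact: (continuous_comp (fc _ Ux) (Lc (f x))).
  by split.
have Lfd v x : U x -> is_derive x v (L \o f) (L ('D_v f x)).
  move=> Ux; have fxv := fk.1 v x Ux.
  have E : (fun h : R => h^-1 *: ((L \o f) (h *: v + x) - (L \o f) x)) =
    L \o (fun h : R => h^-1 *: (f (h *: v + x) - f x)).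
    by apply/funext => h /=; rewrite [RHS]linearZ_LR [in RHS]linearB.
  have H : (fun h : R => h^-1 *: ((L \o f) (h *: v + x) - (L \o f) x)) @ 0^'
     --> L ('D_v f x).
    by rewrite E; apply: (cvg_comp _ _ fxv); exact: Lc.
  apply: DeriveDef; last exact: cvg_lim H.
  by apply/cvg_ex; exists (L ('D_v f x)).
split=> //; split=> [v x Ux|v]; first by have [] := Lfd v x Ux.
by apply: Ck_on_ext (IH _ (fk.2 v)) => // x Ux; have [_ ->] := Lfd v x Ux.
Qed.

Lemma Ck_on_affine {V V' W : normedModType R} k (U : set V') (f : V' -> W)
    (L : {linear V -> V'}) (c : V') : continuous L ->
  Ck_on k U f ->
  Ck_on k ((fun x => L x + c) @^-1` U) (f \o (fun x => L x + c)).
Proof.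
move=> Lc; elim: k f => [|k IH] f [fc fk].
all: have Lfc x : ((fun x => L x + c) @^-1` U) x ->
    {for x, continuous (f \o (fun x => L x + c))} by
  move=> Ux; apply: (@continuous_comp _ _ _ (fun x => L x + c)) (fc _ Ux);
    apply: cvgD; [exact: Lc|exact: cvg_cst].
  by split.
have E v x : (fun h : R => h^-1 *: ((f \o (fun x => L x + c)) (h *: v + x)
     - (f \o (fun x => L x + c)) x)) =
    (fun h : R => h^-1 *: (f (h *: L v + (L x + c)) - f (L x + c))).
  by apply/funext => h /=; rewrite linearP addrA.
split=> //; split=> [v x Ux|v].
  by rewrite /derivable E; exact: fk.1.
have -> : 'D_v (f \o (fun x => L x + c)) = 'D_(L v) f \o (fun x => L x + c).
  by apply/funext => x; rewrite /derive E.
exact/IH/fk.2.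
Qed.

End SmoothOn.

Section Charts.
Context {R : realType}.

(* chart_map and chart_inv are total functions, meaningful on chart_dom and on
   its image only. *)
Record chart (n : nat) (T : topologicalType) := Chart {
  chart_dom : set T;
  chart_map :> T -> 'rV[R]_n;
  chart_inv : 'rV[R]_n -> T;
  chart_dom_open : open chart_dom;
  chart_img_open : open (chart_map @` chart_dom);
  chart_mapK : forall p, chart_dom p -> chart_inv (chart_map p) = p;
  chart_map_continuous : forall p, chart_dom p -> {for p, continuous chart_map};
  chart_inv_continuous : forall x, (chart_map @` chart_dom) x ->
    {for x, continuous chart_inv}
}.

Definition chart_img n (T : topologicalType) (c : chart n T) : set 'rV[R]_n :=
  c @` chart_dom c.

Section ProductChart.
Context {m n : nat} {T U : topologicalType}.

Definition rowl (u : 'rV[R]_m) : 'rV[R]_(m + n) := row_mx u 0.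
Definition rowr (v : 'rV[R]_n) : 'rV[R]_(m + n) := row_mx 0 v.

Fact rowl_is_linear : linear rowl.
Proof. by move=> a u v; rewrite /rowl scale_row_mx add_row_mx scaler0 addr0. Qed.
HB.instance Definition _ :=
  GRing.isLinear.Build R 'rV[R]_m 'rV[R]_(m + n) _ rowl rowl_is_linear.

Fact rowr_is_linear : linear rowr.
Proof. by move=> a u v; rewrite /rowr scale_row_mx add_row_mx scaler0 addr0. Qed.
HB.instance Definition _ :=
  GRing.isLinear.Build R 'rV[R]_n 'rV[R]_(m + n) _ rowr rowr_is_linear.

Lemma continuous_rowl : continuous rowl.
Proof.
move=> u A /nbhs_ballP[e /= e0 eA].
apply/nbhs_ballP; exists e => //= v [_ uv]; apply: eA; split => // i j.
by rewrite !mxE; case: (fintype.split j) => k; [exact: uv|rewrite !mxE; exact: ballxx].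
Qed.

Lemma continuous_rowr : continuous rowr.
Proof.
move=> u A /nbhs_ballP[e /= e0 eA].
apply/nbhs_ballP; exists e => //= v [_ uv]; apply: eA; split => // i j.
by rewrite !mxE; case: (fintype.split j) => k; [rewrite !mxE; exact: ballxx|exact: uv].
Qed.

Lemma row_mxD (u : 'rV[R]_m) (v : 'rV[R]_n) : row_mx u v = rowl u + rowr v.
Proof. by rewrite /rowl /rowr add_row_mx addr0 add0r. Qed.

Context (c : chart m T) (d : chart n U).

Definition prod_chart_dom : set (T * U) := chart_dom c `*` chart_dom d.
Definition prod_chart_map (p : T * U) : 'rV[R]_(m + n) :=
  row_mx (c p.1) (d p.2).
Definition prod_chart_inv (x : 'rV[R]_(m + n)) : T * U :=
  (chart_inv c (lsubmx x), chart_inv d (rsubmx x)).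

Lemma prod_chart_img : prod_chart_map @` prod_chart_dom =
  (lsubmx @^-1` chart_img c) `&` (rsubmx @^-1` chart_img d).
Proof.
apply/seteqP; split=> x.
  by move=> [[p q] [/= cp dq] <-]; rewrite /prod_chart_map /= row_mxKl row_mxKr;
    split; [exists p|exists q].
move=> [/= [p cp px] [q dq qx]]; exists (p, q) => //.
by rewrite /prod_chart_map /= px qx hsubmxK.
Qed.

Lemma prod_chart_dom_open : open prod_chart_dom.
Proof.
rewrite openE => -[p q] [/= cp dq].
exists (chart_dom c, chart_dom d) => //; split => /=.
  by apply: open_nbhs_nbhs; split=> //; exact: chart_dom_open.
by apply: open_nbhs_nbhs; split=> //; exact: chart_dom_open.
Qed.

Lemma prod_chart_img_open : open (prod_chart_map @` prod_chart_dom).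
Proof.
rewrite prod_chart_img; apply: openI; apply: open_comp.
- by move=> x _; exact: continuous_lsubmx.
- exact: chart_img_open.
- by move=> x _; exact: continuous_rsubmx.
- exact: chart_img_open.
Qed.

Lemma prod_chart_mapK p :
  prod_chart_dom p -> prod_chart_inv (prod_chart_map p) = p.
Proof.
case: p => p q [/= cp dq].
by rewrite /prod_chart_inv /prod_chart_map /= row_mxKl row_mxKr !chart_mapK.
Qed.

Lemma prod_chart_map_continuous p :
  prod_chart_dom p -> {for p, continuous prod_chart_map}.
Proof.
move=> [cp dq]; have -> : prod_chart_map =
    (fun p => rowl (c p.1) + rowr (d p.2)).
  by apply/funext => q; exact: row_mxD.
apply: cvgD.
  apply: (@continuous_comp _ _ _ (c \o fst) rowl); last exact: continuous_rowl.
  apply: continuous_comp; first exact: cvg_fst.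
  exact: chart_map_continuous.
apply: (@continuous_comp _ _ _ (d \o snd) rowr); last exact: continuous_rowr.
apply: continuous_comp; first exact: cvg_snd.
exact: chart_map_continuous.
Qed.

Lemma prod_chart_inv_continuous x : (prod_chart_map @` prod_chart_dom) x ->
  {for x, continuous prod_chart_inv}.
Proof.
rewrite prod_chart_img => -[xc xd].
have cx : {for x, continuous (chart_inv c \o lsubmx)}.
  apply: continuous_comp; first exact: continuous_lsubmx.
  exact: chart_inv_continuous.
have dx : {for x, continuous (chart_inv d \o rsubmx)}.
  apply: continuous_comp; first exact: continuous_rsubmx.
  exact: chart_inv_continuous.
exact: (cvg_pair cx dx).
Qed.

Definition prod_chart : chart (m + n) (T * U)%type :=
  Chart prod_chart_dom_open prod_chart_img_open prod_chart_mapK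
    prod_chart_map_continuous prod_chart_inv_continuous.

End ProductChart.
End Charts.
Arguments chart R n T : clear implicits.

Section Manifolds.
Context {R : realType}.

(* The atlas need not be maximal: only the smooth functions it determines are
   used below. *)
Record manifold (n : nat) := Manifold {
  carrier :> topologicalType;
  atlas : set (chart R n carrier);
  manifold_hausdorff : hausdorff_space carrier;
  manifold_second_countable : @second_countable carrier;
  atlas_cover : forall p : carrier, exists2 c, atlas c & chart_dom c p;
  atlas_compatible : forall c d, atlas c -> atlas d ->
    smooth_on (c @` (chart_dom c `&` chart_dom d)) (d \o chart_inv c)
}.

Definition smooth_fun n (M : manifold n) (h : M -> R) : Prop :=
  forall c, atlas c -> smooth_on (chart_img c) (h \o chart_inv c).

Section ProductManifold.
Context {m n : nat} (B : manifold m) (F : manifold n).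

Definition prod_atlas : set (chart R (m + n) (B * F)%type) :=
  [set prod_chart c d | c in @atlas m B & d in @atlas n F].

Lemma prod_hausdorff : hausdorff_space (B * F)%type.
Proof.
move=> [p q] [p' q'] clpq; congr pair.
- apply: (@manifold_hausdorff _ B) => A C Ap Cp.
  have [] := clpq (A `*` setT) (C `*` setT).
  + by exists (A, setT) => //; split => //; exact: filterT.
  + by exists (C, setT) => //; split => //; exact: filterT.
  by move=> [r s] [[/= Ar _] [/= Cr _]]; exists r.
- apply: (@manifold_hausdorff _ F) => A C Aq Cq.
  have [] := clpq (setT `*` A) (setT `*` C).
  + by exists (setT, A) => //; split => //; exact: filterT.
  + by exists (setT, C) => //; split => //; exact: filterT.
  by move=> [r s] [[/= _ Ar] [/= _ Cr]]; exists s.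
Qed.

Lemma prod_second_countable : @second_countable (B * F)%type.
Proof.
have [S cS [oS bS]] := @manifold_second_countable _ B.
have [S' cS' [oS' bS']] := @manifold_second_countable _ F.
exists [set A.1 `*` A.2 | A in S `*` S'].
  by apply: card_le_trans (card_image_le _ _) _; exact: countableX.
split.
  move=> _ [[A C] [/= SA SC] <-]; rewrite openE => -[p q] [/= Ap Cq].
  exists (A, C) => //; split => /=.
    by apply: open_nbhs_nbhs; split=> //; exact: oS.
  by apply: open_nbhs_nbhs; split=> //; exact: oS'.
move=> [p q] W [[A C] [/= /bS [A' [SA' A'p] sA] /bS' [C' [SC' C'q] sC]] sW].
exists (A' `*` C').
  by split; [exists (A', C')|split].
by move=> [r s] [/= /sA Ar /sC Cs]; apply: sW.
Qed.

Lemma prod_atlas_cover (p : (B * F)%type) :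
  exists2 c, prod_atlas c & chart_dom c p.
Proof.
have [c Ac cp] := atlas_cover p.1; have [d Ad dp] := atlas_cover p.2.
by exists (prod_chart c d); [exists c => //; exists d|split].
Qed.

Lemma transition_open k (M : manifold k) (c d : chart R k M) :
  open (c @` (chart_dom c `&` chart_dom d)).
Proof.
rewrite openE => _ [p [cp dp] <-].
have H1 : \forall x \near c p, chart_img c x.
  by apply: open_nbhs_nbhs; split; [exact: chart_img_open|exists p].
have H2 : \forall x \near c p, chart_dom d (chart_inv c x).
  apply: (@chart_inv_continuous _ _ _ c); first by exists p.
  rewrite chart_mapK //.
  by apply: open_nbhs_nbhs; split=> //; exact: chart_dom_open.
apply: filterS2 H1 H2 => x [q cq <-]; rewrite chart_mapK // => dq.
by exists q.
Qed.

Lemma smooth_on_lsubmx (W : normedModType R) (U : set 'rV[R]_m)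
    (f : 'rV[R]_m -> W) : smooth_on U f ->
  smooth_on (lsubmx @^-1` U) (f \o @lsubmx R 1 m n).
Proof.
move=> sf k; have := Ck_on_affine (L := @lsubmx R 1 m n) 0 _ (sf k).
have -> : (fun x : 'rV[R]_(m + n) => lsubmx x + 0) = lsubmx.
  by apply/funext => x; rewrite addr0.
by apply; exact: continuous_lsubmx.
Qed.

Lemma smooth_on_rsubmx (W : normedModType R) (U : set 'rV[R]_n)
    (f : 'rV[R]_n -> W) : smooth_on U f ->
  smooth_on (rsubmx @^-1` U) (f \o @rsubmx R 1 m n).
Proof.
move=> sf k; have := Ck_on_affine (L := @rsubmx R 1 m n) 0 _ (sf k).
have -> : (fun x : 'rV[R]_(m + n) => rsubmx x + 0) = rsubmx.
  by apply/funext => x; rewrite addr0.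
by apply; exact: continuous_rsubmx.
Qed.

Lemma prod_atlas_compatible c d : prod_atlas c -> prod_atlas d ->
  smooth_on (c @` (chart_dom c `&` chart_dom d)) (d \o chart_inv c).
Proof.
move=> [c1 Ac1 [c2 Ac2 <-]] [d1 Ad1 [d2 Ad2 <-]].
set U := (X in smooth_on X _).
pose U1 := c1 @` (chart_dom c1 `&` chart_dom d1).
pose U2 := c2 @` (chart_dom c2 `&` chart_dom d2).
have s1 := smooth_on_lsubmx (atlas_compatible Ac1 Ad1).
have s2 := smooth_on_rsubmx (atlas_compatible Ac2 Ad2).
have sU1 : U `<=` lsubmx @^-1` U1.
  move=> _ [[p q] [[/= cp cq] [/= dp dq]] <-].
  by rewrite /preimage /= /prod_chart_map /= row_mxKl; exists p.
have sU2 : U `<=` rsubmx @^-1` U2.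
  move=> _ [[p q] [[/= cp cq] [/= dp dq]] <-].
  by rewrite /preimage /= /prod_chart_map /= row_mxKr; exists q.
have oU : open U.
  have -> : U = (lsubmx @^-1` U1) `&` (rsubmx @^-1` U2).
    apply/seteqP; split; first by move=> x Ux; split; [exact: sU1|exact: sU2].
    move=> x [/= [p [cp dp] px] [q [cq dq] qx]]; exists (p, q).
      by split; split.
    by rewrite /= /prod_chart_map /= px qx hsubmxK.
  apply: openI; apply: open_comp.
  - by move=> x _; exact: continuous_lsubmx.
  - exact: transition_open.
  - by move=> x _; exact: continuous_rsubmx.
  - exact: transition_open.
move=> k.
have -> : prod_chart d1 d2 \o chart_inv (prod_chart c1 c2) =
    (rowl \o ((d1 \o chart_inv c1) \o lsubmx)) +
    (rowr \o ((d2 \o chart_inv c2) \o rsubmx)).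
  by apply/funext => x; rewrite /= /prod_chart_map /= row_mxD.
apply: Ck_onD => //; apply: Ck_on_lin => //.
- exact: continuous_rowl.
- exact: Ck_on_sub sU1 (s1 k).
- exact: continuous_rowr.
- exact: Ck_on_sub sU2 (s2 k).
Qed.

Definition prod_manifold : manifold (m + n) :=
  Manifold prod_hausdorff prod_second_countable prod_atlas_cover
    prod_atlas_compatible.

Lemma smooth_fun_fst (h : B -> R) :
  smooth_fun h -> @smooth_fun _ prod_manifold (h \o fst).
Proof.
move=> sh _ [c Ac [d Ad <-]] k; rewrite /chart_img prod_chart_img.
exact: Ck_on_sub (@subIsetl _ _ _) (smooth_on_lsubmx (sh c Ac) k).
Qed.

Lemma smooth_fun_snd (h : F -> R) :
  smooth_fun h -> @smooth_fun _ prod_manifold (h \o snd).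
Proof.
move=> sh _ [c Ac [d Ad <-]] k; rewrite /chart_img prod_chart_img.
exact: Ck_on_sub (@subIsetr _ _ _) (smooth_on_rsubmx (sh d Ad) k).
Qed.

Lemma smooth_fun_slice_base (q : F) (h : prod_manifold -> R) :
  smooth_fun h -> smooth_fun (fun b : B => h (b, q)).
Proof.
move=> sh c Ac k; have [d Ad dq] := atlas_cover q.
have Acd : @atlas _ prod_manifold (prod_chart c d) by exists c => //; exists d.
have := Ck_on_affine (L := @rowl R m n) (rowr (d q)) continuous_rowl
  (sh _ Acd k).
have E x : rowl x + rowr (d q) = row_mx x (d q) by rewrite row_mxD.
move=> H; apply: Ck_on_ext (Ck_on_sub _ H); first exact: chart_img_open.
  by move=> x _; rewrite /= E /prod_chart_inv row_mxKl row_mxKr chart_mapK.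
move=> x cx; rewrite /preimage /= E /chart_img prod_chart_img.
by split; rewrite /preimage /= ?row_mxKl ?row_mxKr //; exists q.
Qed.

Lemma smooth_fun_slice_fiber (b : B) (h : prod_manifold -> R) :
  smooth_fun h -> smooth_fun (fun q : F => h (b, q)).
Proof.
move=> sh d Ad k; have [c Ac cb] := atlas_cover b.
have Acd : @atlas _ prod_manifold (prod_chart c d) by exists c => //; exists d.
have := Ck_on_affine (L := @rowr R m n) (rowl (c b)) continuous_rowr
  (sh _ Acd k).
have E x : rowr x + rowl (c b) = row_mx (c b) x by rewrite row_mxD addrC.
move=> H; apply: Ck_on_ext (Ck_on_sub _ H); first exact: chart_img_open.
  by move=> x _; rewrite /= E /prod_chart_inv row_mxKl row_mxKr chart_mapK.
move=> x cx; rewrite /preimage /= E /chart_img prod_chart_img.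
by split; rewrite /preimage /= ?row_mxKl ?row_mxKr //; exists b.
Qed.

End ProductManifold.
End Manifolds.
Arguments manifold R n : clear implicits.

Section SmoothFunctions.
Context {R : realType} {n : nat} (M : manifold R n).

Definition smooth_pred : {pred M -> R} :=
  fun h => `[< @smooth_fun R n M h >].

Record Cinf := MkCinf { Cinf_fun :> M -> R; CinfP : Cinf_fun \in smooth_pred }.
HB.instance Definition _ := [isSub for Cinf_fun].
HB.instance Definition _ := [Choice of Cinf by <:].

Fact smooth_subring : subring_closed smooth_pred.
Proof.
have sM (f g : M -> R) : f \in smooth_pred -> g \in smooth_pred ->
    f * g \in smooth_pred.
  move=> /asboolP sf /asboolP sg; apply/asboolP => c Ac k.
  exact: (Ck_onM (@chart_img_open _ _ _ c) (sf c Ac k) (sg c Ac k)).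
have scst (a : R) : cst a \in smooth_pred.
  by apply/asboolP => c Ac k; exact: Ck_on_cst.
split=> //; first exact: scst.
move=> f g /asboolP sf sg.
have /asboolP sNg := sM _ _ (scst (-1)) sg.
have -> : - g = cst (-1) * g.
  by apply/funext => x; rewrite -[RHS]/(-1 * g x) mulN1r.
apply/asboolP => c Ac k.
exact: (Ck_onD (@chart_img_open _ _ _ c) (sf c Ac k) (sNg c Ac k)).
Qed.

Fact smooth_scaler : GRing.scaler_closed smooth_pred.
Proof.
move=> a f sf.
have -> : a *: f = cst a * f by apply/funext.
have [_ _ sM] := smooth_subring; apply: sM => //.
apply/asboolP => c Ac k; exact: Ck_on_cst.
Qed.

HB.instance Definition _ := GRing.isSubringClosed.Build _
  smooth_pred smooth_subring.
HB.instance Definition _ := GRing.isScaleClosed.Build R _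
  smooth_pred smooth_scaler.
HB.instance Definition _ := GRing.SubChoice_isSubComPzRing.Build _ _ Cinf
  (GRing.subringClosedP _).
HB.instance Definition _ := GRing.SubZmodule_isSubLmodule.Build R _ _ Cinf
  (GRing.subsemimodClosedP _).

Lemma Cinf_smooth (h : Cinf) : smooth_fun h.
Proof. exact/asboolP/CinfP. Qed.

Definition mkCinf (h : M -> R) (sh : smooth_fun h) : Cinf :=
  @MkCinf h (asboolT sh).

End SmoothFunctions.

Section TangentVectors.
Context {R : realType} {n : nat} (M : manifold R n).

Section AtPoint.
Context (p : M).

(* Tangent vectors at p are the derivations at p of the algebra of smooth
   functions on M. *)
Definition derivation_pred : {pred Cinf M -> R} := fun v =>
  `[< (forall (a : R) (h k : Cinf M), v (a *: h + k) = a * v h + v k) /\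
      (forall h k : Cinf M, v (h * k) = v h * k p + h p * v k) >].

Record tangent := MkTangent {
  tangent_fun :> Cinf M -> R;
  tangentP : tangent_fun \in derivation_pred
}.
HB.instance Definition _ := [isSub for tangent_fun].
HB.instance Definition _ := [Choice of tangent by <:].

Fact derivation_submod : submod_closed derivation_pred.
Proof.
split.
  apply/asboolP; split=> [a h k|h k]; first by rewrite /= mulr0 addr0.
  by rewrite /= mul0r mulr0 addr0.
move=> c v w /asboolP[v1 v2] /asboolP[w1 w2]; apply/asboolP.
have E h : (c *: v + w) h = c * v h + w h by [].
split=> [a h k|h k]; rewrite !E ?v1 ?v2 ?w1 ?w2; last by ring.
by ring.
Qed.
HB.instance Definition _ := GRing.isSubmodClosed.Build R _
  derivation_pred derivation_submod.
HB.instance Definition _ := [SubChoice_isSubLmodule of tangent by <:].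

Lemma tangent_linear (v : tangent) (a : R) (h k : Cinf M) :
  v (a *: h + k) = a * v h + v k.
Proof. by have /asboolP[+ _] := tangentP v; exact. Qed.

Lemma tangent_leibniz (v : tangent) (h k : Cinf M) :
  v (h * k) = v h * k p + h p * v k.
Proof. by have /asboolP[_] := tangentP v; exact. Qed.

End AtPoint.
End TangentVectors.

Section VectorFields.
Context {R : realType} {n : nat} (M : manifold R n).

Record vector_field := VectorField {
  vf_at :> forall p : M, tangent p;
  vf_smooth : forall h : Cinf M, smooth_fun (fun p => vf_at p h)
}.

Definition vf_app (X : vector_field) (h : Cinf M) : Cinf M :=
  mkCinf (vf_smooth X h).

Lemma vf_app_linear (X : vector_field) (a : R) (h k : Cinf M) :
  vf_app X (a *: h + k) = a *: vf_app X h + vf_app X k.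
Proof. by apply/val_inj/funext => p; exact: tangent_linear. Qed.

Lemma vf_app_leibniz (X : vector_field) (h k : Cinf M) :
  vf_app X (h * k) = vf_app X h * k + h * vf_app X k.
Proof. by apply/val_inj/funext => p; exact: tangent_leibniz. Qed.

Section LieBracket.
Context (X Y : vector_field).

Definition lie_fun (h : Cinf M) : Cinf M :=
  vf_app X (vf_app Y h) - vf_app Y (vf_app X h).

Fact lie_derivation (p : M) :
  (fun h => lie_fun h p) \in derivation_pred p.
Proof.
have addE (Z : vector_field) (h k : Cinf M) : Z p (h + k) = Z p h + Z p k.
  by rewrite -[h]scale1r tangent_linear scale1r mul1r.
have subE (h k : Cinf M) : (h - k) p = h p - k p by [].
apply/asboolP; split=> [a h k|h k]; rewrite /lie_fun !subE /=.
  by rewrite !vf_app_linear !tangent_linear; ring.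
rewrite !vf_app_leibniz !addE !tangent_leibniz /=; ring.
Qed.

Definition lie_at (p : M) : tangent p := MkTangent (lie_derivation p).

Definition lie_bracket : vector_field :=
  @VectorField lie_at (fun h => Cinf_smooth (lie_fun h)).

End LieBracket.

(* X h, made total by sending the functions that are not smooth to 0. *)
Definition vf_deriv (X : vector_field) (h : M -> R) : M -> R :=
  fun p => X p (insubd (0 : Cinf M) h).

End VectorFields.

Section Differential.
Context {R : realType}.

(* Smooth maps are those that pull smooth functions back to smooth functions,
   which is what the differential of a derivation needs. *)
Record smooth_map {m n : nat} (M : manifold R m) (N : manifold R n) :=
  SmoothMap {
    map_fun :> M -> N;
    map_pullback : forall h : Cinf N, smooth_fun (h \o map_fun)
  }.

Section Pullback.
Context {m n : nat} {M : manifold R m} {N : manifold R n}.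
Context (F : smooth_map M N).

Definition pullback (h : Cinf N) : Cinf M := mkCinf (map_pullback F h).

Fact differential_derivation (p : M) (v : tangent p) :
  (v \o pullback) \in derivation_pred (F p).
Proof.
apply/asboolP; split=> [a h k|h k] /=.
  by rewrite -tangent_linear; congr (v _); exact/val_inj.
have -> : pullback (h * k) = pullback h * pullback k by exact/val_inj.
exact: tangent_leibniz.
Qed.

Definition differential (p : M) (v : tangent p) : tangent (F p) :=
  MkTangent (differential_derivation v).

Lemma differential_linear (p : M) (a : R) (v w : tangent p) :
  differential (a *: v + w) = a *: differential v + differential w.
Proof. exact/val_inj. Qed.

End Pullback.
End Differential.

Section Products.
Context {R : realType} {m n : nat} (B : manifold R m) (F : manifold R n).
Notation BF := (prod_manifold B F).

Definition proj_base : smooth_map BF B :=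
  @SmoothMap _ _ _ BF B fst
    (fun h => smooth_fun_fst (F := F) (Cinf_smooth h)).
Definition proj_fiber : smooth_map BF F :=
  @SmoothMap _ _ _ BF F snd
    (fun h => smooth_fun_snd (B := B) (Cinf_smooth h)).

Definition slice_base (q : F) : smooth_map B BF :=
  @SmoothMap _ _ _ B BF (fun b => (b, q))
    (fun h => smooth_fun_slice_base q (Cinf_smooth h)).
Definition slice_fiber (b : B) : smooth_map F BF :=
  @SmoothMap _ _ _ F BF (fun q => (b, q))
    (fun h => smooth_fun_slice_fiber b (Cinf_smooth h)).

(* The second conjunct says that X is tangent to the submanifolds B * {q}. *)
Definition is_lift_base (XB : vector_field B) (X : vector_field BF) : Prop :=
  (forall p : BF, differential proj_base (X p) = XB p.1) /\
  (forall (b : B) (q : F),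
     exists v : tangent b, X (b, q) = differential (slice_base q) v).

Definition is_lift_fiber (VF : vector_field F) (V : vector_field BF) : Prop :=
  (forall p : BF, differential proj_fiber (V p) = VF p.2) /\
  (forall (b : B) (q : F),
     exists v : tangent q, V (b, q) = differential (slice_fiber b) v).

End Products.

Section Metrics.
Context {R : realType}.

(* No nondegeneracy and no smoothness is required here; smoothness is part of
   singular_metric. *)
Record sym_form {n : nat} (M : manifold R n) := SymForm {
  form_at :> forall p : M, {biscalar (tangent p)};
  form_sym : forall (p : M) (x y : tangent p), form_at p x y = form_at p y x
}.

Record singular_metric {n : nat} (M : manifold R n) := SingularMetric {
  metric_form :> sym_form M;
  metric_smooth : forall X Y : vector_field M,
    smooth_fun (fun p => metric_form p (X p) (Y p))
}.

(* For a smooth g the inner products differentiated here are smooth, hence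
   vf_deriv is the genuine derivative. *)
Definition koszul {n : nat} (M : manifold R n) (g : sym_form M)
    (X Y Z : vector_field M) : M -> R :=
  let ip (X Y : vector_field M) : M -> R := fun p => g p (X p) (Y p) in
  fun p => 2^-1 *
    (vf_deriv X (ip Y Z) p + vf_deriv Y (ip Z X) p - vf_deriv Z (ip X Y) p
     - ip X (lie_bracket Y Z) p + ip Y (lie_bracket Z X) p
     + ip Z (lie_bracket X Y) p).

Section Warped.
Context {m n : nat} {B : manifold R m} {F : manifold R n}.
Context (gB : sym_form B) (gF : sym_form F) (f : Cinf B).
Notation BF := (prod_manifold B F).

Definition warped_at (p : BF) (x y : tangent p) : R :=
  gB p.1 (differential (proj_base B F) x) (differential (proj_base B F) y) +
  f p.1 ^+ 2 *
    gF p.2 (differential (proj_fiber B F) x) (differential (proj_fiber B F) y).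

Fact warped_bilinear (p : BF) :
  bilinear_for *%R *%R (@warped_at p).
Proof.
split=> [y a x x'|y a x x']; rewrite /warped_at !differential_linear.
  by rewrite !linearPl /= !mulrDr mulrCA addrACA.
by rewrite linearPr linearPr /= !mulrDr mulrCA addrACA.
Qed.
HB.instance Definition _ (p : BF) :=
  bilinear_isBilinear.Build R (tangent p) (tangent p) R *%R *%R
    (@warped_at p) (warped_bilinear p).

Fact warped_sym (p : BF) (x y : tangent p) : warped_at x y = warped_at y x.
Proof. by rewrite /warped_at form_sym [in X in _ + X]form_sym. Qed.

(* The metric of the warped product, as a field of symmetric bilinear forms:
   the Koszul form does not take the smoothness proof as an argument. *)
Definition warped_form : sym_form BF :=
  @SymForm _ BF (fun p => @warped_at p) warped_sym.

End Warped.
End Metrics.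

(* Main.v *)
(** A lift from B is proj_base-related to its base field and proj_fiber-related
    to 0, and symmetrically for lifts from F.  For fields X, Y, Z projecting to
    (XB, XF), (YB, YF), (ZB, ZF), relatedness is stable under brackets, so the
    Leibniz rule yields a single formula
      K(X,Y,Z) = K_B(XB,YB,ZB) + f^2 K_F(XF,YF,ZF)
        + f (XB(f) <YF,ZF> + YB(f) <ZF,XF> - ZB(f) <XF,YF>),
    and each of the four cases is obtained by setting some projections to 0. *)
Require Import Defs.
From mathcomp Require Import all_boot all_order all_algebra.
From mathcomp Require Import all_classical reals topology normedtype derive.
From mathcomp Require Import ring.

Import Order.TTheory GRing.Theory Num.Theory.
Import numFieldNormedType.Exports.
Local Open Scope ring_scope.

Section TangentTheory.
Context {R : realType} {n : nat} {M : manifold R n}.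

Lemma tangentD (p : M) (v : tangent p) (h k : Cinf M) : v (h + k) = v h + v k.
Proof. by rewrite -[h]scale1r tangent_linear mul1r scale1r. Qed.

Lemma tangent0 (p : M) (v : tangent p) : v 0 = 0.
Proof. by apply: (addrI (v 0)); rewrite -tangentD !addr0. Qed.

Lemma tangent1 (p : M) (v : tangent p) : v 1 = 0.
Proof.
apply: (addrI (v 1)); rewrite addr0 -[in RHS](mulr1 1) tangent_leibniz.
by rewrite mulr1 mul1r.
Qed.

(** Here [h] is [a] times the unit, which every derivation kills by Leibniz on 1 = 1 * 1. *)
Lemma tangent_cst (p : M) (v : tangent p) (a : R) (h : Cinf M) :
  (forall q, h q = a) -> v h = 0.
Proof.
move=> ha; have -> : h = a *: (1 : Cinf M) + (0 : Cinf M).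
  by apply/val_inj/funext => q /=; rewrite ha addr0 /= -[RHS]/(a * 1) mulr1.
by rewrite tangent_linear tangent1 tangent0 mulr0 addr0.
Qed.

(** On a bundled smooth function [insubd] never falls back to its default 0. *)
Lemma vf_derivE (X : vector_field M) (h : Cinf M) (p : M) :
  vf_deriv X h p = X p h.
Proof. by rewrite /vf_deriv -[Cinf_fun h]/(val h) valKd. Qed.

Definition vf0 : vector_field M :=
  @VectorField R n M (fun=> 0) (fun=> @Cinf_smooth R n M 0).

Lemma lie_bracket0l (X : vector_field M) (p : M) : lie_bracket vf0 X p = 0.
Proof.
apply/val_inj/funext => h /=; rewrite /lie_fun.
by rewrite -[LHS]/(0 - X p (vf_app vf0 h)) (tangent_cst _ _ 0 (vf_app vf0 h)) ?subrr.
Qed.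

Lemma lie_bracket0r (X : vector_field M) (p : M) : lie_bracket X vf0 p = 0.
Proof.
apply/val_inj/funext => h /=; rewrite /lie_fun.
by rewrite -[LHS]/(X p (vf_app vf0 h) - 0) (tangent_cst _ _ 0 (vf_app vf0 h)) ?subrr.
Qed.

Lemma vf_deriv0 (X : vector_field M) (p : M) : vf_deriv X (fun=> 0) p = 0.
Proof. by rewrite -[fun=> 0]/(Cinf_fun (0 : Cinf M)) vf_derivE tangent0. Qed.

(** The zero derivation also kills the default value that [vf_deriv] substitutes for a non-smooth
    [h]. *)
Lemma vf_deriv_vf0 (h : M -> R) (p : M) : vf_deriv vf0 h p = 0.
Proof. by []. Qed.

Context (g : sym_form M).

Lemma form0l (X : vector_field M) :
  (fun p => g p (vf0 p) (X p)) = (fun=> 0).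
Proof. by apply/funext => p; rewrite linear0l. Qed.

Lemma form0r (X : vector_field M) :
  (fun p => g p (X p) (vf0 p)) = (fun=> 0).
Proof. by apply/funext => p; rewrite linear0r. Qed.

(** In each of the six terms [vf0] differentiates, is paired by [g], or sits in a bracket. The same
    holds for the other two slots. *)
Lemma koszul0l (Y Z : vector_field M) (p : M) : koszul g vf0 Y Z p = 0.
Proof.
rewrite /koszul; cbv beta zeta; rewrite form0l form0r !vf_deriv0 vf_deriv_vf0.
by rewrite lie_bracket0l lie_bracket0r linear0l !linear0r !(addr0, subr0) mulr0.
Qed.

Lemma koszul0m (X Z : vector_field M) (p : M) : koszul g X vf0 Z p = 0.
Proof.
rewrite /koszul; cbv beta zeta; rewrite form0l form0r !vf_deriv0 vf_deriv_vf0.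
by rewrite lie_bracket0l lie_bracket0r linear0l !linear0r !(addr0, subr0) mulr0.
Qed.

Lemma koszul0r (X Y : vector_field M) (p : M) : koszul g X Y vf0 p = 0.
Proof.
rewrite /koszul; cbv beta zeta; rewrite form0l form0r !vf_deriv0 vf_deriv_vf0.
by rewrite lie_bracket0l lie_bracket0r linear0l !linear0r !(addr0, subr0) mulr0.
Qed.

End TangentTheory.

Section Related.
Context {R : realType} {m n : nat} {M : manifold R m} {N : manifold R n}.
Context (phi : smooth_map M N).

Definition related (X : vector_field M) (Y : vector_field N) : Prop :=
  forall p, differential phi (X p) = Y (phi p).

Lemma related_app {X Y} : related X Y ->
  forall p h, X p (pullback phi h) = Y (phi p) h.
Proof. by move=> XY p h; rewrite -XY. Qed.

Lemma related_lie (X1 X2 : vector_field M) (Y1 Y2 : vector_field N) :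
  related X1 Y1 -> related X2 Y2 ->
  related (lie_bracket X1 X2) (lie_bracket Y1 Y2).
Proof.
move=> r1 r2 p; apply/val_inj/funext => h.
(* Relatedness says that [pullback phi] intertwines the two fields as operators, hence also their
   commutators. *)
have appE X Y : related X Y ->
    vf_app X (pullback phi h) = pullback phi (vf_app Y h).
  by move=> XY; apply/val_inj/funext => q; exact: related_app.
rewrite /= /lie_fun (appE _ _ r1) (appE _ _ r2).
rewrite -[LHS]/(X1 p (pullback phi (vf_app Y2 h))
              - X2 p (pullback phi (vf_app Y1 h))).
by rewrite (related_app r1) (related_app r2).
Qed.

End Related.

Section WarpedKoszul.
Context {R : realType} {m n : nat} {B : manifold R m} {F : manifold R n}.
Local Notation BF := (prod_manifold B F).

Definition projects (X : vector_field BF) (XB : vector_field B)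
    (XF : vector_field F) : Prop :=
  related (proj_base B F) X XB /\ related (proj_fiber B F) X XF.

Lemma lift_base_projects (XB : vector_field B) (X : vector_field BF) :
  is_lift_base XB X -> projects X XB vf0.
Proof.
move=> [pX tX]; split=> // -[b q]; have [v ->] := tX b q.
(* The slice at [q] followed by the projection to [F] is constant, so [h] pulls back to the constant
   [h q]. *)
by apply/val_inj/funext => h /=; apply: (tangent_cst _ _ (h q) _).
Qed.

Lemma lift_fiber_projects (VF : vector_field F) (V : vector_field BF) :
  is_lift_fiber VF V -> projects V vf0 VF.
Proof.
move=> [pV tV]; split=> // -[b q]; have [v ->] := tV b q.
by apply/val_inj/funext => h /=; apply: (tangent_cst _ _ (h b) _).
Qed.

Context (gB : singular_metric B) (gF : singular_metric F) (f : Cinf B).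

(** Bundling the inner product in [Cinf] is where smoothness of the metrics enters: it can then be
    pulled back and differentiated. *)
Definition metric_app {k} {M : manifold R k} (g : singular_metric M)
  (X Y : vector_field M) : Cinf M := mkCinf (metric_smooth g X Y).

Lemma warped_projects X XB XF Y YB YF p :
  projects X XB XF -> projects Y YB YF ->
  warped_form gB gF f p (X p) (Y p) =
  gB p.1 (XB p.1) (YB p.1) + f p.1 ^+ 2 * gF p.2 (XF p.2) (YF p.2).
Proof.
by move=> [XBr XFr] [YBr YFr]; rewrite /= /warped_at XBr XFr YBr YFr.
Qed.

Lemma projects_lie X XB XF Y YB YF :
  projects X XB XF -> projects Y YB YF ->
  projects (lie_bracket X Y) (lie_bracket XB YB) (lie_bracket XF YF).
Proof. by move=> [? ?] [? ?]; split; exact: related_lie. Qed.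

Lemma deriv_warped X XB XF Y YB YF Z ZB ZF p :
  projects X XB XF -> projects Y YB YF -> projects Z ZB ZF ->
  vf_deriv X (fun p => warped_form gB gF f p (Y p) (Z p)) p =
  vf_deriv XB (fun p => gB p (YB p) (ZB p)) p.1
  + f p.1 ^+ 2 * vf_deriv XF (fun p => gF p (YF p) (ZF p)) p.2
  + 2 * f p.1 * XB p.1 f * gF p.2 (YF p.2) (ZF p.2).
Proof.
move=> [XBr XFr] hY hZ.
pose pB := pullback (proj_base B F); pose pF := pullback (proj_fiber B F).
(* Exhibiting the inner product as an element of [Cinf] makes [vf_deriv] a genuine derivative. The
   square is written as a product so that Leibniz yields the factor [2 * f p.1]. *)
have -> : (fun p => warped_form gB gF f p (Y p) (Z p)) =
    Cinf_fun (pB (metric_app gB YB ZB)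
              + pB f * pB f * pF (metric_app gF YF ZF)).
  by apply/funext => r; rewrite (warped_projects _ _ _ _ _ _ _ hY hZ) expr2.
rewrite vf_derivE tangentD !tangent_leibniz !(related_app _ XBr).
rewrite (related_app _ XFr).
rewrite -(vf_derivE XB (metric_app _ _ _)) -(vf_derivE XF (metric_app _ _ _)) /=.
rewrite -[((_ \o _) * _) p]/(f p.1 * f p.1).
by ring.
Qed.

(** The brackets project to brackets, so their terms split between the two factors without
    differentiating [f]. The three derivative terms supply the corrections, whose factor 2 cancels
    the 1/2 of the Koszul form. *)
Lemma koszul_warped X XB XF Y YB YF Z ZB ZF p :
  projects X XB XF -> projects Y YB YF -> projects Z ZB ZF ->
  koszul (warped_form gB gF f) X Y Z p =
  koszul gB XB YB ZB p.1 + f p.1 ^+ 2 * koszul gF XF YF ZF p.2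
  + f p.1 * (XB p.1 f * gF p.2 (YF p.2) (ZF p.2)
             + YB p.1 f * gF p.2 (ZF p.2) (XF p.2)
             - ZB p.1 f * gF p.2 (XF p.2) (YF p.2)).
Proof.
move=> hX hY hZ; rewrite /koszul /=.
have ipE A AB AF C CB CF := warped_projects A AB AF C CB CF p.
rewrite (deriv_warped _ _ _ _ _ _ _ _ _ _ hX hY hZ).
rewrite (deriv_warped _ _ _ _ _ _ _ _ _ _ hY hZ hX).
rewrite (deriv_warped _ _ _ _ _ _ _ _ _ _ hZ hX hY).
rewrite (ipE _ _ _ _ _ _ hX (projects_lie _ _ _ _ _ _ hY hZ)).
rewrite (ipE _ _ _ _ _ _ hY (projects_lie _ _ _ _ _ _ hZ hX)).
rewrite (ipE _ _ _ _ _ _ hZ (projects_lie _ _ _ _ _ _ hX hY)).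
by field.
Qed.

End WarpedKoszul.

Theorem proposition3p6 (R : realType) (m n : nat)
    (B : manifold R m) (F : manifold R n)
    (gB : singular_metric B) (gF : singular_metric F) (f : Cinf B)
    (XB YB ZB : vector_field B) (UF VF WF : vector_field F)
    (X Y Z U V W : vector_field (prod_manifold B F))
    (hX : is_lift_base XB X) (hY : is_lift_base YB Y) (hZ : is_lift_base ZB Z)
    (hU : is_lift_fiber UF U) (hV : is_lift_fiber VF V) (hW : is_lift_fiber WF W) :
  let K := koszul (warped_form gB gF f) in
  let fVWXf (p : prod_manifold B F) :=
    f p.1 * gF p.2 (VF p.2) (WF p.2) * X p (pullback (proj_base B F) f) in
  [/\ forall p, K X Y Z p = koszul gB XB YB ZB p.1,
      forall p, [/\ K X Y W p = 0, K X W Y p = 0 & K W X Y p = 0],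
      forall p, [/\ K X V W p = fVWXf p, K V X W p = fVWXf p
                  & - K V W X p = fVWXf p] &
      forall p, K U V W p = f p.1 ^+ 2 * koszul gF UF VF WF p.2].
Proof.
move=> K fVWXf.
have pX := lift_base_projects _ _ hX; have pY := lift_base_projects _ _ hY.
have pZ := lift_base_projects _ _ hZ; have pU := lift_fiber_projects _ _ hU.
have pV := lift_fiber_projects _ _ hV; have pW := lift_fiber_projects _ _ hW.
have XE p : X p (pullback (proj_base B F) f) = XB p.1 f.
  exact: related_app _ hX.1 _ _.
have KE := koszul_warped gB gF f.
(* In the mixed cases both Koszul terms contain a [vf0]; a correction term survives only when a base
   field differentiates [f] and the two others come from [F]. *)
pose zeroE := (@koszul0l, @koszul0m, @koszul0r, @linear0l, @linear0r).
split=> p; [|split|split|]; rewrite /K /fVWXf ?XE.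
- by rewrite (KE _ _ _ _ _ _ _ _ _ _ pX pY pZ) !zeroE /=; ring.
- by rewrite (KE _ _ _ _ _ _ _ _ _ _ pX pY pW) !zeroE /=; ring.
- by rewrite (KE _ _ _ _ _ _ _ _ _ _ pX pW pY) !zeroE /=; ring.
- by rewrite (KE _ _ _ _ _ _ _ _ _ _ pW pX pY) !zeroE /=; ring.
- by rewrite (KE _ _ _ _ _ _ _ _ _ _ pX pV pW) !zeroE /=; ring.
(* The cyclic order of the formula leaves the pairing of [WF] with [VF], reversed with respect to
   [fVWXf]. *)
- rewrite (KE _ _ _ _ _ _ _ _ _ _ pV pX pW) (form_sym _ _ (VF p.2)).
  by rewrite !zeroE /=; ring.
- by rewrite (KE _ _ _ _ _ _ _ _ _ _ pV pW pX) !zeroE /=; ring.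
- by rewrite (KE _ _ _ _ _ _ _ _ _ _ pU pV pW) !zeroE /=; ring.
Qed.
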